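(* Let $X$ be a complex Banach space, $k\in\mathbb{Z}$, $n\in\mathbb{N}_0$, and let $\hat f_k:\mathbb{R}^2\times\mathbb{R}\to X$ be a mode $k$ function with radial coefficient $f_k:[0,\infty)\times\mathbb{R}\to X$, assumed sufficiently differentiable. Then, in polar coordinates (for $r>0$), $$\partial_\zeta\hat f_k=\mathrm{e}^{\mathrm{i}(k-1)\theta}\tfrac{1}{\sqrt2}\mathcal{D}_kf_k,\qquad \partial_{\overline\zeta}\hat f_k=\mathrm{e}^{\mathrm{i}(k+1)\theta}\tfrac{1}{\sqrt2}\mathcal{D}_{-k}f_k,$$ and more generally $$\partial_{\overline\zeta}^{\,n-i}\partial_\zeta^{\,i}\hat f_k=\mathrm{e}^{\mathrm{i}(k+n-2i)\theta}\,2^{-\frac n2}\,\mathcal{D}_{-k+i}^{\,n-i}\mathcal{D}_k^{\,i}f_k\qquad\text{for } 0\le i\le n.$$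
   Context: A mode $k$ function is a function $\hat f_k:\mathbb{R}^2\times\mathbb{R}\to X$ with $\hat f_k(r\cos\theta,r\sin\theta,z)=\mathrm{e}^{\mathrm{i}k\theta}f_k(r,z)$ for $r\ge0$, $\theta\in\mathbb{T}^1$, $z\in\mathbb{R}$, where $f_k:[0,\infty)\times\mathbb{R}\to X$ (the radial coefficient) satisfies $f_k(0,z)=0$ if $k\neq0$. The coordinates on $\mathbb{R}^2$ are $(x,y)$ and $\partial_\zeta:=\frac1{\sqrt2}(\partial_x-\mathrm{i}\partial_y)$, $\partial_{\overline\zeta}:=\frac1{\sqrt2}(\partial_x+\mathrm{i}\partial_y)$. For $j\in\mathbb{Z}$ the Bessel operator is $\mathcal{D}_j:=\frac{\mathrm d}{\mathrm dr}+\frac jr$ and $\mathcal{D}_j^n:=\mathcal{D}_{j-(n-1)}\mathcal{D}_{j-(n-2)}\cdots\mathcal{D}_{j-1}\mathcal{D}_j$ ($\mathcal{D}_j^0$ is the identity). ''Sufficiently differentiable'' means that $\hat f_k$ has continuous partial derivatives in $(x,y)$ up to the order appearing. *)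

(* Defs.v *)
From HB Require Import structures.
From mathcomp Require Import all_boot all_order all_algebra complex.
From mathcomp Require Import all_classical all_reals all_analysis.

Set Implicit Arguments.
Unset Strict Implicit.
Unset Printing Implicit Defensive.

Import Order.TTheory GRing.Theory Num.Theory.
Import numFieldNormedType.Exports.

Local Open Scope classical_set_scope.
Local Open Scope ring_scope.
Local Open Scope complex_scope.

(** Restriction of scalars.  The library's ['D_v f], [derivable] and [derive1]
    require the source and the target to be normed over the same field, so a
    complex normed space [X] has to be viewed as a real one before functions of
    real variables with values in [X] can be differentiated. *)
Definition realify (R : realType) (X : normedModType R[i]) : Type := X.

Section Realify.
Context {R : realType} {X : normedModType R[i]}.

HB.instance Definition _ := GRing.Zmodule.copy (realify X) X.

Let realify_scale (a : R) (x : realify X) : realify X := a%:C *: (x : X).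

Let realify_scaleA a b v :
  realify_scale a (realify_scale b v) = realify_scale (a * b) v.
Proof. by rewrite /realify_scale scalerA rmorphM. Qed.

Let realify_scale1 : left_id 1 realify_scale.
Proof. by move=> x; rewrite /realify_scale scale1r. Qed.

Let realify_scaleDr : right_distributive realify_scale +%R.
Proof. by move=> a x y; rewrite /realify_scale [LHS]scalerDr. Qed.

Let realify_scaleDl v : {morph realify_scale^~ v : a b / a + b}.
Proof. by move=> a b; rewrite /realify_scale rmorphD [LHS]scalerDl. Qed.

HB.instance Definition _ := GRing.Zmodule_isLmodule.Build R (realify X)
  realify_scaleA realify_scale1 realify_scaleDr realify_scaleDl.

(* [`|x|] is a nonnegative complex number, that is, a real one. *)
Let realify_norm (x : realify X) : R := complex.Re `|x : X|.

Let realify_normE (x : realify X) : (realify_norm x)%:C = `|x : X|.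
Proof. by rewrite /realify_norm RRe_real // realE normr_ge0. Qed.

Let realify_normD x y :
  realify_norm (x + y) <= realify_norm x + realify_norm y.
Proof. by rewrite -lecR rmorphD /= !realify_normE ler_normD. Qed.

Let realify_normZ (a : R) x : realify_norm (a *: x) = `|a| * realify_norm x.
Proof.
apply: complexI; rewrite rmorphM /= !realify_normE.
by rewrite [in LHS]/GRing.scale /= normrZ normc_def /= expr0n addr0 sqrtr_sqr.
Qed.

Let realify_norm0 x : realify_norm x = 0 -> x = 0.
Proof.
by move=> x0; apply/(@normr0_eq0 _ X); rewrite -realify_normE x0.
Qed.

HB.instance Definition _ := Lmodule_isNormed.Build R (realify X)
  realify_normD realify_normZ realify_norm0.

Lemma realify_scaleE (a : R) (x : realify X) : a *: x = a%:C *: (x : X).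
Proof. by []. Qed.

Lemma norm_realifyE (x : realify X) : `|x|%:C = `|x : X|.
Proof. exact: realify_normE. Qed.

Lemma nbhs_realifyE (x : X) : nbhs (x : realify X) = nbhs x.
Proof.
apply/seteqP; split => A.
- move=> /(@nbhs_normP R (realify X)) [e /= e0 eA].
  apply/(@nbhs_normP R[i] X); exists e%:C; first by rewrite /= ltcR.
  move=> y /=; rewrite -(norm_realifyE (x - y : X)) ltcR; exact: eA.
- move=> /(@nbhs_normP R[i] X) [e /= e0 eA].
  have eE : e = (complex.Re e)%:C by rewrite RRe_real // realE ltW.
  apply/(@nbhs_normP R (realify X)).
  exists (complex.Re e); first by rewrite /= -ltcR -eE.
  move=> y /=; rewrite -ltcR norm_realifyE -eE; exact: eA.
Qed.

End Realify.

Section Definitions.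
Context {R : realType} {X : normedModType R[i]}.
Implicit Types (g : R * R * R -> X) (u f : R * R -> X).

Definition expi (t : R) : R[i] := cos t +i* sin t.

(** A point of the space R^2 x R is [(x, y, z)], i.e. [((x, y), z)]. *)

Definition partial_x g : R * R * R -> X :=
  fun p => 'D_((1, 0, 0) : R * R * R) (g : R * R * R -> realify X) p.

Definition partial_y g : R * R * R -> X :=
  fun p => 'D_((0, 1, 0) : R * R * R) (g : R * R * R -> realify X) p.

(** [g] has continuous partial derivatives in [(x, y)] up to order [n]; the
    variable [z] is a parameter. *)
Fixpoint Cxy (n : nat) g : Prop :=
  (forall z, continuous (fun q : R * R => g (q, z))) /\
  if n is m.+1 then
    [/\ forall p, derivable (g : R * R * R -> realify X) p (1, 0, 0),
        forall p, derivable (g : R * R * R -> realify X) p (0, 1, 0),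
        Cxy m (partial_x g) & Cxy m (partial_y g)]
  else True.

Definition partial_zeta g : R * R * R -> X :=
  fun p => ((Num.sqrt 2)^-1)%:C *: (partial_x g p - 'i%C *: partial_y g p).

Definition partial_zetabar g : R * R * R -> X :=
  fun p => ((Num.sqrt 2)^-1)%:C *: (partial_x g p + 'i%C *: partial_y g p).

(** Functions of [(r, z)] are total; only their values at [r >= 0] are
    constrained, and [bessel] is only meant at [r > 0], where it depends on
    positive radii only. *)

Definition mode_function (k : int) g f : Prop :=
  (forall r theta z, 0 <= r ->
     g (r * cos theta, r * sin theta, z) = expi (k%:~R * theta) *: f (r, z)) /\
  (k != 0 -> forall z, f (0, z) = 0).

Definition bessel (j : int) u : R * R -> X :=
  fun p => (derive1 (fun s => u (s, p.2) : realify X) p.1 : X)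
           + (j%:~R / p.1)%:C *: u p.

Fixpoint besseln (j : int) (n : nat) u : R * R -> X :=
  if n is m.+1 then bessel (j - m%:Z) (besseln j m u) else u.

(** The limits defining the successive radial derivatives in [besseln j n u]
    exist at [(r, z)]: ['D_v] and [derive1] are total operators. *)
Definition besseln_defined (j : int) (n : nat) u (r z : R) : Prop :=
  forall m, (m < n)%N ->
    derivable (fun s => besseln j m u (s, z) : realify X) r 1.

End Definitions.

(* Main.v *)
(** Near a point at distance [r > 0] and angle [al] from the axis, a mode [j]
    function is [expi (j * (al + theta)) *: u rho], where [theta] and [rho] are
    explicit smooth functions of the displacement.  The coefficient [u] is
    differentiable because it is the restriction of the mode function to the
    half-axis [theta = 0]; hence every directional derivative in the plane
    follows from the chain rule in one variable, and no total differentiability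
    is needed.  This shows that [partial_zeta] and [partial_zetabar] turn modes
    [j] into modes [j - 1] and [j + 1], and the general formula is obtained by
    iteration. *)

Require Import Defs.
From mathcomp Require Import all_boot all_order all_algebra complex.
From mathcomp Require Import ring zify.
From mathcomp Require Import all_classical all_reals all_analysis.

Set Implicit Arguments.
Unset Strict Implicit.
Unset Printing Implicit Defensive.

Import Order.TTheory GRing.Theory Num.Theory.
Import numFieldNormedType.Exports.
Local Open Scope classical_set_scope.
Local Open Scope ring_scope.
Local Open Scope complex_scope.

(** * Product, chain and line rules for vector-valued derivatives *)

(** The difference quotient splits into the quotient of [c] times [v (h + x)] plus [c x] times the
    quotient of [v]; the first term converges because [v], being derivable, is continuous at [x]. *)
Lemma is_derive_scale (R : numFieldType) (V : normedModType R)
    (c : R -> R) (v : R -> V) (x dc : R) (dv : V) :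
  is_derive x 1 c dc -> is_derive x 1 v dv ->
  is_derive x 1 (fun t => c t *: v t) (dc *: v x + c x *: dv).
Proof.
move=> [c' <-] [v' <-].
have H : h^-1 *: (((fun t => c t *: v t) \o shift x) (h *: 1) - c x *: v x)
    @[h --> 0^'] --> 'D_1 c x *: v x + c x *: 'D_1 v x.
  have -> : (fun h : R =>
        h^-1 *: (((fun t => c t *: v t) \o shift x) (h *: 1) - c x *: v x)) =
      (fun h => (h^-1 *: ((c \o shift x) (h *: 1) - c x)) *: v (h + x) +
                c x *: (h^-1 *: ((v \o shift x) (h *: 1) - v x))).
    apply/funext => h /=; rewrite [h%:A]mulr1.
    rewrite -[h^-1 *: (c _ - c x)]/(h^-1 * (c (h + x) - c x)) -scalerA.
    rewrite (scalerA (c x)) (mulrC (c x)) -(scalerA h^-1) -scalerDr.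
    by congr (_ *: _); rewrite scalerBl scalerBr addrA subrK.
  apply: cvgD; last exact: cvgZl_tmp.
  apply: cvgZ => //.
  have /derivable1P/derivable1_diffP/differentiable_continuous := v'.
  move=> /continuous_withinNx; rewrite scale0r add0r.
  by under eq_fun do rewrite [_%:A]mulr1.
by split; [apply/cvg_ex; eexists; exact: H | exact: cvg_lim H].
Qed.

Lemma is_derive_comp (R : numFieldType) (V : normedModType R)
    (u : R -> V) (g : R -> R) (x dg : R) (du : V) :
  is_derive (g x) 1 u du -> is_derive x 1 g dg ->
  is_derive x 1 (fun t => u (g t)) (dg *: du).
Proof.
move=> [u' <-] [g' <-].
move: (u') (g') => /derivable1_diffP du' /derivable1_diffP dg'.
have d : differentiable (u \o g) x by exact: differentiable_comp.
split; first exact/derivable1_diffP.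
rewrite -!derive1E derive1E' // diff_comp // !derive1E' //=.
by rewrite -[X in 'd u _ X = _]mulr1 [LHS]linearZ.
Qed.

(** Both difference quotients are the same function of [h]. This turns directional derivatives into
    derivatives in one variable at 0. *)
Lemma is_derive_line (R : numFieldType) (V W : normedModType R) (f : V -> W)
    (p v : V) (df : W) :
  is_derive p v f df <-> is_derive (0 : R) (1 : R) (fun h : R => f (h *: v + p)) df.
Proof.
have E : (fun h : R => h^-1 *: ((f \o shift p) (h *: v) - f p)) =
    (fun h => h^-1 *: (((fun h => f (h *: v + p)) \o shift 0) (h *: 1)
                       - f (0 *: v + p))).
  by apply/funext => h /=; rewrite addr0 scale0r add0r [h%:A]mulr1.
by split=> -[d e]; split; move: d e; rewrite /derivable /derive E.
Qed.

Lemma near_eq_is_derive (R : numFieldType) (V W : normedModType R)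
    (f g : V -> W) (a v : V) (df : W) :
  {near a, f =1 g} -> is_derive a v f df -> is_derive a v g df.
Proof.
move=> fg [d e]; split; first exact: near_eq_derivable fg d.
by rewrite -(near_eq_derive _ fg).
Qed.

(** * Polar coordinates along a line through a point of the half-axis *)

Section Polar.
Context {R : realType}.
Implicit Types r a b t al : R.

(* The polar coordinates of the point [(r + t a, t b)] when [r + t a > 0]. *)
Definition angle r a b t : R := atan (t * b / (r + t * a)).
Definition radius r a b t : R := (r + t * a) / cos (angle r a b t).

Lemma cos_atan_gt0 t : 0 < cos (atan t).
Proof. by rewrite cos_atan invr_gt0 sqrtr_gt0 ltr_wpDr ?sqr_ge0. Qed.

Lemma radius_gt0 r a b t : 0 < r + t * a -> 0 < radius r a b t.
Proof. by move=> h; rewrite divr_gt0 // cos_atan_gt0. Qed.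

Lemma radius_cos r a b t : radius r a b t * cos (angle r a b t) = r + t * a.
Proof. by rewrite divfK // gt_eqF // cos_atan_gt0. Qed.

(** The left side is [r + t * a] times the tangent of the angle, and [tan] undoes [atan]. *)
Lemma radius_sin r a b t : 0 < r + t * a ->
  radius r a b t * sin (angle r a b t) = t * b.
Proof.
move=> h; have := atanK (t * b / (r + t * a)).
rewrite /tan -/(angle r a b t) /radius => e.
by rewrite -mulrA [_^-1 * _]mulrC e mulrC divfK // gt_eqF.
Qed.

Lemma is_derive_affine a b : is_derive (0 : R) (1 : R) (fun t => a + t * b) b.
Proof.
have -> : (fun t => a + t * b) = cst a + b \*: id.
  by apply/funext => t /=; rewrite mulrC.
by apply: is_derive_eq; rewrite add0r [_%:A]mulr1.
Qed.

Lemma is_derive_angle r a b : 0 < r -> is_derive (0 : R) (1 : R) (angle r a b) (b / r).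
Proof.
move=> r0.
have d1 : is_derive (0 : R) (1 : R) (fun t => t * b) b.
  have -> : ( *%R^~ b : R -> R) = (fun t => 0 + t * b).
    by apply/funext => t; rewrite add0r.
  exact: is_derive_affine.
have d2 := is_derive_affine r a.
have nz : r + 0 * a != 0 by rewrite mul0r addr0 gt_eqF.
have d3 := @is_deriveV R (fun t => r + t * a) _ _ _ nz d2.
have d4 := @is_derive_scale _ _ (fun t => t * b) _ _ _ _ d1 d3.
have d5 := @is_derive1_comp _ (@atan R) _ _ _ _ (is_derive1_atan _) d4.
apply: is_derive_eq d5 _.
by rewrite !mul0r !scale0r !addr0 expr0n addr0 invr1 mul1r.
Qed.

(** The angle vanishes at [t = 0], so its variation enters with the factor [sin 0]: to first order
    only the radial component [a] counts. *)
Lemma is_derive_radius r a b : 0 < r ->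
  is_derive (0 : R) (1 : R) (radius r a b) a.
Proof.
move=> r0.
have d1 := @is_derive1_comp _ (@cos R) _ _ _ _ (is_derive_cos _)
  (is_derive_angle a b r0).
have a0 : angle r a b 0 = 0 by rewrite /angle !mul0r atan0.
have nz : (cos \o angle r a b) 0 != 0 by rewrite /= a0 cos0 oner_neq0.
have d2 := @is_deriveV R _ _ _ _ nz d1.
have d3 := @is_derive_scale _ _ _ _ _ _ _ (is_derive_affine r a) d2.
apply: is_derive_eq d3 _.
by rewrite /= a0 sin0 cos0 oppr0 !mul0r [- _ *: _]mulr0 [_ *: 0]mulr0 addr0 invr1
  [_ *: _]mulr1.
Qed.

End Polar.

(** * Complex scalars and phases under real differentiation *)

Section Realified.
Context {R : realType} {X : normedModType R[i]}.

Lemma cvg_realify {T : Type} (F : set_system T) (f : T -> X) (a : X) :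
  f x @[x --> F] --> a <->
  (f : T -> realify X) x @[x --> F] --> (a : realify X).
Proof. by rewrite /cvg_to nbhs_realifyE. Qed.

(** Multiplication by [b] is a scaling of [X] but not of the real space [realify X], so the limit is
    taken in [X] and carried back by [cvg_realify]. *)
Lemma is_derive_complexZ (V : normedModType R) (b : R[i]) (f : V -> realify X)
    (p v : V) (df : realify X) :
  is_derive p v f df ->
  is_derive p v (fun q => b *: (f q : X) : realify X) (b *: (df : X)).
Proof.
move=> [f' <-].
have H : h^-1 *: (((fun q => b *: (f q : X) : realify X) \o shift p) (h *: v)
      - (b *: (f p : X) : realify X))
    @[h --> 0^'] --> (b *: ('D_v f p : X) : realify X).
  have -> : (fun h : R => h^-1 *:
        (((fun q => b *: (f q : X) : realify X) \o shift p) (h *: v)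
        - (b *: (f p : X) : realify X))) =
      (fun h => b *: (h^-1 *: ((f \o shift p) (h *: v) - f p) : X)).
    apply/funext => h /=; rewrite !realify_scaleE.
    by rewrite -[X in _ *: X](@scalerBr _ X) !scalerA mulrC.
  by apply/cvg_realify; apply: cvgZl_tmp; apply/cvg_realify; exact: f'.
by split; [apply/cvg_ex; eexists; exact: H | exact: cvg_lim H].
Qed.

Lemma derivable_complexZ (V : normedModType R) (c : R) (f : V -> realify X)
    (p v : V) : c != 0 ->
  derivable (fun q => c%:C *: (f q : X) : realify X) p v -> derivable f p v.
Proof.
move=> c0 /derivableP /(is_derive_complexZ c^-1%:C) [+ _].
have -> // : (fun q => c^-1%:C *: (c%:C *: (f q : X)) : realify X) = f.
by apply/funext => q; rewrite scalerA -rmorphM mulVf // scale1r.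
Qed.

Lemma expi_scale (t : R) (x : X) :
  expi t *: x = (cos t *: (x : realify X) +
                 sin t *: ('i%C *: x : realify X) : X).
Proof.
rewrite !realify_scaleE scalerA -[RHS]scalerDl; congr (_ *: _).
by apply/eqP; rewrite eq_complex /=; apply/andP; split; apply/eqP; ring.
Qed.

Lemma expi0 : expi (0 : R) = 1.
Proof. by rewrite /expi cos0 sin0. Qed.

Lemma expiD (s t : R) : expi (s + t) = expi s * expi t.
Proof.
rewrite /expi cosD sinD; apply/eqP; rewrite eq_complex /=.
by apply/andP; split; apply/eqP; ring.
Qed.

(** Splitting the phase into cosine and sine leaves real scalar factors, to which the product rule
    [is_derive_scale] applies. *)
Lemma is_derive_expiZ (phi : R -> R) (w : R -> realify X) (x dphi : R)
    (dw : realify X) :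
  is_derive x 1 phi dphi -> is_derive x 1 w dw ->
  is_derive x 1 (fun t => expi (phi t) *: (w t : X) : realify X)
    (expi (phi x) *: (dw + (dphi *: ('i%C *: (w x : X) : realify X)) : X)).
Proof.
move=> phi' w'.
have -> : (fun t => expi (phi t) *: (w t : X) : realify X) =
   (fun t => cos (phi t) *: w t) +
   (fun t => sin (phi t) *: ('i%C *: (w t : X) : realify X)).
  by apply/funext => t; rewrite expi_scale.
have iw' := is_derive_complexZ 'i%C w'.
have c' : is_derive x 1 (fun t => cos (phi t)) (- sin (phi x) * dphi).
  exact: is_derive1_comp.
have s' : is_derive x 1 (fun t => sin (phi t)) (cos (phi x) * dphi).
  exact: is_derive1_comp.
apply: is_derive_eq (is_deriveD (is_derive_scale c' w')
                                (is_derive_scale s' iw')) _.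
rewrite expi_scale !realify_scaleE.
clear w' iw' c' s'.
move: (w x) dw (cos (phi x)) (sin (phi x)) => {}w {}dw c s.
change ((- s * dphi)%:C *: (w : X) + c%:C *: (dw : X) +
  ((c * dphi)%:C *: ('i%C *: (w : X)) + s%:C *: ('i%C *: (dw : X))) =
  c%:C *: ((dw : X) + dphi%:C *: ('i%C *: (w : X))) +
  s%:C *: ('i%C *: ((dw : X) + dphi%:C *: ('i%C *: (w : X))))).
rewrite !scalerDr !scalerA [RHS]addrACA (addrC ((- s * _)%:C *: _)).
rewrite (addrC ((c * dphi)%:C * _ *: _)) [LHS]addrACA.
congr (_ + _); rewrite addrC; congr (_ *: _ + _ *: _).
  by rewrite rmorphM.
by apply/eqP; rewrite eq_complex /=; apply/andP; split; apply/eqP; ring.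
Qed.

(** * First derivatives of a mode function in polar form *)

(** The mode identity restricted to positive radii, where [bessel] is meaningful; this is the
    invariant of the iteration. *)
Definition polar_form (j : int) (g : R * R * R -> X) (u : R * R -> X) :=
  forall r t z, 0 < r ->
    g (r * cos t, r * sin t, z) = expi (j%:~R * t) *: u (r, z).

Lemma derive_polar (g : R * R * R -> X) (u : R * R -> X) (j : int)
    (r al z a b : R) (dw : realify X) :
  polar_form j g u ->
  0 < r ->
  is_derive r (1 : R) (fun s => u (s, z) : realify X) dw ->
  is_derive ((r * cos al, r * sin al, z) : R * R * R) ((a, b, 0) : R * R * R)
    (g : R * R * R -> realify X)
    (expi (j%:~R * al) *: (((a * cos al + b * sin al) *: dw +
       (j%:~R * ((b * cos al - a * sin al) / r)) *:
         ('i%C *: u (r, z) : realify X) : realify X) : X)).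
Proof.
move=> gE r0 u'.
(* Radial and tangential components of the direction [(a, b)] at angle [al]. *)
set a' := a * cos al + b * sin al; set b' := b * cos al - a * sin al.
apply/is_derive_line.
pose phi t : R := j%:~R * (al + angle r a' b' t).
pose rho := radius r a' b'.
have rho0 : rho 0 = r.
  by rewrite /rho /radius /angle !mul0r atan0 cos0 divr1 addr0.
have phi0 : phi 0 = j%:~R * al by rewrite /phi /angle !mul0r atan0 addr0.
have phi' : is_derive (0 : R) (1 : R) phi (j%:~R * (b' / r)).
  have d := is_deriveZ j%:~R (is_deriveD (is_derive_cst al (0 : R) (1 : R))
              (is_derive_angle a' b' r0)).
  by apply: is_derive_eq d _; rewrite add0r.
have v' : is_derive (0 : R) (1 : R) (fun t => u (rho t, z) : realify X)
    (a' *: dw).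
  apply: (@is_derive_comp _ _ (fun s => u (s, z) : realify X)).
    by rewrite rho0.
  exact: is_derive_radius.
have := is_derive_expiZ phi' v'; rewrite phi0 rho0.
apply: near_eq_is_derive.
(* The polar form holds at positive radius only, so the two functions are compared for small [t]. *)
have : \forall t \near (0 : R), 0 < r + t * a'.
  have : {for 0, continuous (fun t : R => r + t * a')}.
    apply/differentiable_continuous/derivable1_diffP.
    by have [] := is_derive_affine r a'.
  by move=> c; apply: (cvgr_gt _ c); rewrite mul0r addr0.
apply: filterS => t t0.
rewrite /phi -gE ?radius_gt0 //.
(* Rotating [(r + t * a', t * b')] by [al] must give back the base point displaced by [t] times
   [(a, b)]. *)
rewrite cosD sinD.
have rc := radius_cos r a' b' t; have rs := radius_sin b' t0.
rewrite -/(rho t) in rc rs.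
have cs := cos2Dsin2 al.
congr (g (_, _, _)).
- rewrite -[RHS]/(t * a + r * cos al).
  transitivity (cos al * (rho t * cos (angle r a' b' t)) -
                sin al * (rho t * sin (angle r a' b' t))); first by ring.
  rewrite rc rs /a' /b'.
  transitivity (t * a * (cos al ^+ 2 + sin al ^+ 2) + r * cos al); first by ring.
  by rewrite cs mulr1.
- rewrite -[RHS]/(t * b + r * sin al).
  transitivity (sin al * (rho t * cos (angle r a' b' t)) +
                cos al * (rho t * sin (angle r a' b' t))); first by ring.
  rewrite rc rs /a' /b'.
  transitivity (t * b * (cos al ^+ 2 + sin al ^+ 2) + r * sin al); first by ring.
  by rewrite cs mulr1.
- by rewrite -[RHS]/(t * 0 + z) mulr0 add0r.
Qed.

(** On the half-axis of angle 0 the phase is 1, so [u (s, z)] equals [g (s, 0, z)] for [s] near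
    [r]. *)
Lemma derivable_radial (g : R * R * R -> X) (u : R * R -> X) (j : int)
    (r z : R) :
  polar_form j g u ->
  0 < r ->
  derivable (g : R * R * R -> realify X) ((r, 0, z) : R * R * R) (1, 0, 0) ->
  derivable (fun s => u (s, z) : realify X) r 1.
Proof.
move=> gE r0 /derivable1P g'; apply/derivable1P.
apply: near_eq_derivable g'.
have : \forall h \near (0 : R), 0 < r + h.
  have : {for 0, continuous (fun t : R => r + t)}.
    by apply: continuousD; [exact: cst_continuous|exact: cvg_id].
  by move=> c; apply: (cvgr_gt _ c); rewrite addr0.
apply: filterS => t t0.
have := gE (r + t) 0 z t0.
rewrite cos0 sin0 !mulr0 mulr1 => gE0.
rewrite expi0 scale1r in gE0.
rewrite [t%:A]mulr1 (addrC t) -gE0; congr (g (_, _, _)).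
- by rewrite -[LHS]/(t * 1 + r) mulr1 addrC.
- by rewrite -[LHS]/(t * 0 + 0) mulr0 addr0.
- by rewrite -[LHS]/(t * 0 + z) mulr0 add0r.
Qed.

Local Notation s2 := ((Num.sqrt 2)^-1)%:C.

Lemma polar_form_radial j g u : polar_form j g u ->
  (forall p, derivable (g : R * R * R -> realify X) p (1, 0, 0)) ->
  forall r z, 0 < r -> derivable (fun s => u (s, z) : realify X) r 1.
Proof.
by move=> gu dg r z r0; apply: (@derivable_radial g u j).
Qed.

(* [eps = 1] gives [partial_zeta] and [eps = -1] gives [partial_zetabar]. *)
Definition partial_pm (eps : int) (g : R * R * R -> X) : R * R * R -> X :=
  fun p => s2 *: (partial_x g p - ('i%C * eps%:~R) *: partial_y g p).

Lemma partial_pm1 : partial_pm 1 = partial_zeta.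
Proof. by apply/funext => g; apply/funext => p; rewrite /partial_pm mulr1. Qed.

Lemma partial_pmN1 : partial_pm (-1) = partial_zetabar.
Proof.
apply/funext => g; apply/funext => p.
by rewrite /partial_pm mulrN1 scaleNr opprK.
Qed.

(** In polar coordinates $\partial_x - i\epsilon\partial_y = e^{-i\epsilon\theta}(\partial_r -
    \frac{i\epsilon}{r}\partial_\theta)$. On mode $j$, $\partial_\theta$ is multiplication by $ij$,
    which leaves $\partial_r + \epsilon j/r$ and shifts the mode by $-\epsilon$. *)
Lemma polar_form_partial_pm (eps j : int) g u : eps = 1 \/ eps = -1 ->
  polar_form j g u ->
  (forall p, derivable (g : R * R * R -> realify X) p (1, 0, 0)) ->
  polar_form (j - eps) (partial_pm eps g)
    (fun p => s2 *: bessel (eps * j) u p).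
Proof.
move=> eps2 gu dg r t z r0.
have /derivableP du := polar_form_radial gu dg (z := z) r0.
rewrite -derive1E in du.
have D a b := @derive_val _ _ _ _ _ _ _
  (@derive_polar g u j r t z a b _ gu r0 du).
rewrite /partial_pm /partial_x /partial_y !D /bessel /= !mul1r !mul0r !addr0.
rewrite !add0r subr0.
move: (derive1 _ _) (u _) => du0 u0; rewrite !realify_scaleE.
have -> : expi ((j - eps)%:~R * t) = expi (j%:~R * t) * expi (- (eps%:~R * t)).
  by rewrite -expiD rmorphB /= mulrBl.
have -> : expi (- (eps%:~R * t)) = (cos t)%:C - 'i%C * eps%:~R * (sin t)%:C.
  rewrite /expi cosN sinN; case: eps2 => ->;
  rewrite ?mulr1z ?mulrN1z ?mul1r ?mulN1r ?cosN ?sinN;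
  apply/eqP; rewrite eq_complex /=; apply/andP; split; apply/eqP; ring.
change (s2 *: (expi (j%:~R * t) *:
   ((cos t)%:C *: (du0 : X) + (j%:~R * (- sin t / r))%:C *: ('i%C *: u0)) -
   ('i%C * eps%:~R) *: (expi (j%:~R * t) *:
    ((sin t)%:C *: (du0 : X) + (j%:~R * (cos t / r))%:C *: ('i%C *: u0)))) =
  expi (j%:~R * t) * ((cos t)%:C - 'i%C * eps%:~R * (sin t)%:C) *:
    (s2 *: ((du0 : X) + ((eps * j)%:~R / r)%:C *: u0))).
rewrite [RHS]scalerA (mulrC _ s2) -[RHS]scalerA -[in RHS]scalerA.
congr (_ *: _); rewrite (scalerA _ (expi _)) (mulrC _ (expi _)) -scalerA -scalerBr.
congr (_ *: _); rewrite !scalerDr !scalerA opprD addrACA -!scalerBl.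
congr (_ *: _ + _ *: _).
(* The coefficients of [u0] agree because $\epsilon^2 = 1$. *)
case: eps2 => ->; rewrite ?mul1r ?mulN1r ?mulrNz ?mulr1z ?mulr1;
  apply/eqP; rewrite eq_complex /=; apply/andP; split; apply/eqP; ring.
Qed.

(** * Regularity of the derivatives and iteration *)

Lemma Cxy_lincomb m (a b : R[i]) g h :
  @Cxy R X m g -> Cxy m h -> Cxy m (fun p => a *: g p + b *: h p).
Proof.
elim: m g h => [|m IH] g h /= [cg Hg] [ch Hh]; split.
- by move=> z q; apply: cvgD; apply: cvgZl_tmp; [exact: cg|exact: ch].
- by [].
- by move=> z q; apply: cvgD; apply: cvgZl_tmp; [exact: cg|exact: ch].
case: Hg => gx gy gxc gyc; case: Hh => hx hy hxc hyc.
have D v p : derivable (g : R * R * R -> realify X) p v ->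
    derivable (h : R * R * R -> realify X) p v ->
    is_derive p v (fun p => a *: g p + b *: h p : realify X)
      ((a *: ('D_v (g : R * R * R -> realify X) p : X) +
        b *: ('D_v (h : R * R * R -> realify X) p : X) : X) : realify X).
  move=> /derivableP dg /derivableP dh.
  exact: is_deriveD (is_derive_complexZ a dg) (is_derive_complexZ b dh).
split.
- by move=> p; have [] := D _ _ (gx p) (hx p).
- by move=> p; have [] := D _ _ (gy p) (hy p).
- have -> : partial_x (fun p => a *: g p + b *: h p) =
      (fun p => a *: partial_x g p + b *: partial_x h p).
    by apply/funext => p; have [_] := D _ _ (gx p) (hx p).
  exact: IH.
- have -> : partial_y (fun p => a *: g p + b *: h p) =
      (fun p => a *: partial_y g p + b *: partial_y h p).
    by apply/funext => p; have [_] := D _ _ (gy p) (hy p).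
  exact: IH.
Qed.

Lemma Cxy_partial_pm eps m g : Cxy m.+1 g -> Cxy m (partial_pm eps g).
Proof.
case=> _ [_ _ gx gy].
have := Cxy_lincomb s2 (- (s2 * ('i%C * eps%:~R))) gx gy.
by under eq_fun do rewrite scaleNr -scalerA -scalerBr.
Qed.

Lemma besselZ (j : int) (u : R * R -> X) (c : R) (r z : R) :
  derivable (fun s => u (s, z) : realify X) r 1 ->
  bessel j (fun p => c%:C *: u p) (r, z) = c%:C *: bessel j u (r, z).
Proof.
move=> du; rewrite /bessel /= !derive1E.
have -> : (fun s => c%:C *: u (s, z) : realify X) =
    c \*: (fun s => u (s, z) : realify X) by [].
rewrite deriveZ // realify_scaleE [in RHS]scalerDr !scalerA.
by rewrite (mulrC c%:C).
Qed.

(** Each application spends one order of regularity. The scalar [c] lets the lemma be applied again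
    to its own output, whose coefficient already carries a power of $2^{-1/2}$; since it is nonzero,
    derivability passes from the scaled coefficient to the unscaled one. *)
Lemma iter_partial_pm (eps j : int) g u (c : R) (m i : nat) :
  eps = 1 \/ eps = -1 -> c != 0 -> Cxy (i + m) g ->
  polar_form j g (fun p => c%:C *: u p) ->
  [/\ Cxy m (iter i (partial_pm eps) g),
      polar_form (j - eps * i%:Z) (iter i (partial_pm eps) g)
        (fun p => (c * (Num.sqrt 2)^-1 ^+ i)%:C *: besseln (eps * j) i u p) &
      forall r z, 0 < r -> besseln_defined (eps * j) i u r z].
Proof.
move=> eps2 c0; elim: i m => [|i IH] m Cg gu.
  by split=> //; rewrite mulr0 subr0 mulr1.
have [CG GB dB] := IH m.+1 ltac:(by rewrite addnS) gu.
case: (CG) => _ [dx _ _ _].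
pose C := c * (Num.sqrt 2)^-1 ^+ i.
have C0 : C != 0 by rewrite mulf_neq0 // expf_neq0 // invr_eq0 sqrtr_eq0 -ltNge.
have dBr r z : 0 < r ->
    derivable (fun s => besseln (eps * j) i u (s, z) : realify X) r 1.
  by move=> r0; apply/(derivable_complexZ C0)/(polar_form_radial GB dx).
split; first exact: Cxy_partial_pm.
  move=> r t z r0; rewrite /= (polar_form_partial_pm eps2 GB dx) //=.
  rewrite (besselZ _ _ (dBr r z r0)).
  have -> : j - eps * i%:Z - eps = j - eps * i.+1%:Z by rewrite -addn1 PoszD; ring.
  (* As $\epsilon^2 = 1$, the index produced by the new mode is that of the next factor in
     [besseln]. *)
  have -> : eps * (j - eps * i%:Z) = eps * j - i%:Z by case: eps2 => ->; ring.
  congr (_ *: _).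
  rewrite scalerA -rmorphM /=; congr (_%:C *: _).
  by rewrite exprSr mulrC mulrA.
move=> r z r0 k; rewrite ltnS leq_eqVlt => /predU1P[->|/dB]; first exact: dBr.
exact.
Qed.

End Realified.

Lemma powR2_half (R : realType) (n : nat) :
  2 `^ (- (n%:R / 2)) = (Num.sqrt 2)^-1 ^+ n :> R.
Proof.
by rewrite powRN mulrC powRrM powR12_sqrt ?powR_mulrn ?sqrtr_ge0 // exprVn.
Qed.

Theorem proposition2p2 (R : realType) (X : completeNormedModType R[i])
    (k : int) (n : nat) (fhat : R * R * R -> X) (f : R * R -> X)
    (fhat_mode : mode_function k fhat f) :
  (Cxy 1 fhat ->
   forall r theta z : R, 0 < r ->
     [/\ besseln_defined k 1 f r z,
         besseln_defined (- k) 1 f r z,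
         partial_zeta fhat (r * cos theta, r * sin theta, z) =
           expi ((k - 1)%:~R * theta) *:
             (((Num.sqrt 2)^-1)%:C *: bessel k f (r, z)) &
         partial_zetabar fhat (r * cos theta, r * sin theta, z) =
           expi ((k + 1)%:~R * theta) *:
             (((Num.sqrt 2)^-1)%:C *: bessel (- k) f (r, z))]) /\
  (Cxy n fhat ->
   forall i : nat, (i <= n)%N ->
   forall r theta z : R, 0 < r ->
     [/\ besseln_defined k i f r z,
         besseln_defined (- k + i%:Z) (n - i) (besseln k i f) r z &
         iter (n - i) partial_zetabar (iter i partial_zeta fhat)
             (r * cos theta, r * sin theta, z) =
           expi ((k + n%:Z - (2 * i)%:Z)%:~R * theta) *:
             ((2 `^ (- (n%:R / 2)))%:C *:
               besseln (- k + i%:Z) (n - i) (besseln k i f) (r, z))]).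
Proof.
have eps1 : (1 : int) = 1 \/ (1 : int) = -1 by left.
have epsN1 : (-1 : int) = 1 \/ (-1 : int) = -1 by right.
have f_polar : polar_form k fhat (fun p => (1 : R)%:C *: f p).
  by move=> r t z r0; rewrite scale1r fhat_mode.1 // ltW.
have oner0 : (1 : R) != 0 by exact: oner_neq0.
split=> [C1 r t z r0|Cn i le_in r t z r0].
  (* The first-order formulas are a single iteration for each sign, with no regularity left over. *)
  have [_ P1 D1] := @iter_partial_pm _ _ _ _ _ _ _ 0 1 eps1 oner0 C1 f_polar.
  have [_ P2 D2] := @iter_partial_pm _ _ _ _ _ _ _ 0 1 epsN1 oner0 C1 f_polar.
  move: P1 D1 P2 D2; rewrite /= !mul1r !mulN1r partial_pm1 partial_pmN1 expr1.
  rewrite opprK !subr0 => P1 D1 P2 D2.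
  by split; [exact: D1|exact: D2|exact: P1|exact: P2].
rewrite -(subnKC le_in) in Cn.
have [C1 P1 D1] := iter_partial_pm eps1 oner0 Cn f_polar.
rewrite -[X in Cxy X _]addn0 in C1.
have c0 : 1 * (Num.sqrt 2)^-1 ^+ i != 0 :> R.
  by rewrite mul1r expf_neq0 // invr_eq0 sqrtr_eq0 -ltNge.
(* The second run starts from mode [k - i] with scalar $2^{-i/2}$: its Bessel index is [- (k - i)],
   its final mode [k - i + (n - i)], and the scalars multiply to $2^{-n/2}$. *)
have [_ P2 D2] := iter_partial_pm epsN1 c0 C1 P1.
move: P1 D1 P2 D2; rewrite /= !mul1r !mulN1r partial_pm1 partial_pmN1.
rewrite -exprD subnKC // opprB (addrC _ (- k)) => _ D1 P2 D2.
split; [exact: D1|exact: D2|].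
rewrite P2 // powR2_half; congr (expi (_%:~R * _) *: _); lia.
Qed.
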